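(* Let $(M,d)$ be a metric space, let $(E,\rho)$ be a complete metric space, and let $T:M\to E$ be a $K$-Lipschitz map with $K>0$. Then there exist a complete metric space $(M_T,\overline d_T)$, an inclusion/quotient $1$-Lipschitz map $j:M\to M_T$ and a $K$-Lipschitz map $\overline T:M_T\to E$ such that $T=\overline T\circ j$. Here $\overline d_T$ is the metric associated to the pseudometric $$d_T(x,y):=\frac1K\,\rho(T(x),T(y)),\qquad x,y\in M,$$ that is, $(M_T,\overline d_T)$ is the completion of the quotient metric space $(M^*,d_T^* )$ of $M$ by the relation $d_T(x,y)=0$, with $d_T^*([x],[y])=d_T(x,y)$.
   Context: A metric space is not assumed complete unless stated. A map $f$ between metric spaces $(X,d_X)$ and $(Z,d_Z)$ is $K$-Lipschitz if $d_Z(f(x),f(y))\le K\,d_X(x,y)$ for all $x,y\in X$ and $K$ is the smallest constant satisfying this inequality. For metric spaces $M$ and $N$, a map $j:M\to N$ is an inclusion/quotient map if $j(M)$ is dense in $N$ and there is an equivalence relation on $M$ such that $j(x)=j(y)$ whenever $x,y$ belong to the same equivalence class; that is, $j$ is a quotient map onto a dense subspace of $N$. *)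

(* Defs.v *)
From HB Require Import structures.
From mathcomp Require Import all_boot all_order all_algebra.
From mathcomp Require Import all_classical all_reals all_analysis.

Set Implicit Arguments.
Unset Strict Implicit.
Unset Printing Implicit Defensive.

Import Order.TTheory GRing.Theory Num.Theory.
Local Open Scope classical_set_scope.
Local Open Scope ring_scope.

Section MetricNotions.
Context {R : realType}.

(* The library's [completeType] is a pointed type.  This is the same condition
   on Cauchy filters, for spaces without a distinguished point. *)
Definition complete_metric (X : metricType R) : Prop :=
  forall F : set_system X, ProperFilter F -> cauchy F -> exists l : X, F --> l.

Definition lipschitz_bound (X Z : metricType R) (K : R) (f : X -> Z) : Prop :=
  forall x y : X, mdist (f x) (f y) <= K * mdist x y.

(* [K] is the optimal constant.  Constants are nonnegative: when [X] has at most
   one point, every real number is a bound and the optimal constant is 0. *)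
Definition is_lipschitz (X Z : metricType R) (K : R) (f : X -> Z) : Prop :=
  [/\ 0 <= K, lipschitz_bound K f &
      forall K' : R, 0 <= K' -> lipschitz_bound K' f -> K <= K'].

(* The quotient is set-theoretic: the classes of [e] are exactly the nonempty
   fibres of [j].  No quotient topology is involved. *)
Definition inclusion_quotient (X Y : metricType R) (j : X -> Y) : Prop :=
  dense (range j) /\
  exists2 e : rel X, equivalence_rel e & forall x y, e x y <-> j x = j y.

Definition isometric (X Y : metricType R) (f : X -> Y) : Prop :=
  forall x y : X, mdist (f x) (f y) = mdist x y.

Definition is_completion (X Y : metricType R) (i : X -> Y) : Prop :=
  [/\ complete_metric Y, isometric i & dense (range i)].

End MetricNotions.

Record pseudometric (R : realType) (X : Type) := Pseudometric {
  pdist :> X -> X -> R ;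
  pdist_ge0 : forall x y, 0 <= pdist x y ;
  pdistxx : forall x, pdist x x = 0 ;
  pdist_sym : forall x y, pdist x y = pdist y x ;
  pdist_triangle : forall y x z, pdist x z <= pdist x y + pdist y z }.

Section MetricQuotient.
Local Open Scope quotient_scope.
Context {R : realType} {X : choiceType} (d : pseudometric R X).

Definition pdist_eq0 : rel X := fun x y => d x y == 0.

Lemma pdist_eq0_refl : reflexive pdist_eq0.
Proof. by move=> x; rewrite /pdist_eq0 pdistxx. Qed.

Lemma pdist_eq0_sym : symmetric pdist_eq0.
Proof. by move=> x y; rewrite /pdist_eq0 pdist_sym. Qed.

Lemma pdist_eq0_trans : transitive pdist_eq0.
Proof.
move=> y x z /eqP xy /eqP yz; rewrite /pdist_eq0 eq_le pdist_ge0 andbT.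
by rewrite (le_trans (pdist_triangle d y x z))// xy yz addr0.
Qed.

Canonical pdist_eq0_equiv :=
  EquivRel pdist_eq0 pdist_eq0_refl pdist_eq0_sym pdist_eq0_trans.

Definition metric_quotient : Type := {eq_quot pdist_eq0_equiv}.

HB.instance Definition _ := Choice.on metric_quotient.
HB.instance Definition _ := EqQuotient.on metric_quotient.

Definition quotient_dist (a b : metric_quotient) : R := d (repr a) (repr b).

Lemma quotient_dist_pi (x y : X) :
  quotient_dist (\pi_metric_quotient x) (\pi_metric_quotient y) = d x y.
Proof.
have reprE z : d (repr (\pi_metric_quotient z)) z = 0.
  by apply/eqP; change (pdist_eq0_equiv (repr (\pi_metric_quotient z)) z);
     rewrite -eqmodE reprK.
have le_rep u v u' v' : d u u' = 0 -> d v' v = 0 -> d u v <= d u' v'.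
  move=> uu' v'v; rewrite (le_trans (pdist_triangle d u' u v))// uu' add0r.
  by rewrite (le_trans (pdist_triangle d v' u' v))// v'v addr0.
rewrite /quotient_dist; apply/eqP; rewrite eq_le.
by apply/andP; split; apply: le_rep; rewrite ?reprE// pdist_sym reprE.
Qed.

Lemma quotient_distxx a : quotient_dist a a = 0.
Proof. exact: pdistxx. Qed.

Lemma quotient_dist_eq0 a b : quotient_dist a b = 0 -> a = b.
Proof.
move=> ab; rewrite -(reprK a) -(reprK b); apply/eqP.
by rewrite eqmodE; exact/eqP.
Qed.

Lemma quotient_dist_sym a b : quotient_dist a b = quotient_dist b a.
Proof. exact: pdist_sym. Qed.

Lemma quotient_dist_triangle b a c :
  quotient_dist a c <= quotient_dist a b + quotient_dist b c.
Proof. exact: pdist_triangle. Qed.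

HB.instance Definition _ := @isMetric.Build R metric_quotient quotient_dist
  quotient_distxx quotient_dist_eq0 quotient_dist_sym quotient_dist_triangle.

Definition quotient_proj (x : X) : metric_quotient := \pi_metric_quotient x.

Lemma mdist_quotient_proj (x y : X) :
  mdist (quotient_proj x) (quotient_proj y) = d x y.
Proof. exact: quotient_dist_pi. Qed.

End MetricQuotient.

Section PullbackPseudometric.
Context {R : realType} {M E : metricType R} (K : R) (K0 : 0 < K) (T : M -> E).

Definition pullback_dist (x y : M) : R := K^-1 * mdist (T x) (T y).

Lemma pullback_dist_ge0 x y : 0 <= pullback_dist x y.
Proof. by rewrite mulr_ge0 ?mdist_ge0// invr_ge0 ltW. Qed.

Lemma pullback_distxx x : pullback_dist x x = 0.
Proof. by rewrite /pullback_dist mdistxx mulr0. Qed.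

Lemma pullback_dist_sym x y : pullback_dist x y = pullback_dist y x.
Proof. by rewrite /pullback_dist metric_sym. Qed.

Lemma pullback_dist_triangle y x z :
  pullback_dist x z <= pullback_dist x y + pullback_dist y z.
Proof.
by rewrite /pullback_dist -mulrDr ler_wpM2l ?invr_ge0 ?(ltW K0)// metric_triangle.
Qed.

Definition pullback_pseudometric : pseudometric R M :=
  Pseudometric pullback_dist_ge0 pullback_distxx pullback_dist_sym
    pullback_dist_triangle.

End PullbackPseudometric.

(* Main.v *)
Require Import Defs.
From HB Require Import structures.
From mathcomp Require Import all_boot all_order all_algebra.
From mathcomp Require Import all_classical all_reals all_analysis.
Import Order.TTheory GRing.Theory Num.Theory.
Local Open Scope classical_set_scope.
Local Open Scope ring_scope.

(** The pseudometric of [T] only sees the points [T x]: up to the factor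
    [K^-1], the quotient of [M] is the subspace [range T] of [E].  As [E] is
    complete, the completion of that subspace is its closure in [E], so no
    abstract completion has to be built: [MT] is [closure (range T)] with the
    distance of [E] divided by [K] ([scaled_subspace]).  The inclusion of [MT]
    in [E] multiplies distances by [K]; it serves as [Tbar], and it transports
    the completeness of [E] back to [MT] ([similitude_complete]).  The
    embedding [i] sends a class to the value of [T] on it, and [j] sends [x] to
    its class, hence to [T x]; its range is dense since it is [range T] inside
    the closure of [range T].

    The scaling makes [K] a bound for [Tbar], and turns the bound [K] of [T]
    into the bound [1] of [j].  Both are optimal because their product is the optimal constant of
    [Tbar \o j = T]: a better bound for either factor would improve on [K]
    ([is_lipschitz_compW]). *)

Section MetricFacts.
Context {R : realType}.
Implicit Types X Y Z : metricType R.

Lemma closure_mdist {X} {A : set X} {x : X} {e : R} :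
  closure A x -> 0 < e -> exists2 a, A a & mdist x a < e.
Proof.
move=> clAx e0; have [a [Aa xa]] := clAx _ (nbhsx_ballx x _ e0).
by exists a => //; rewrite ballEmdist in xa.
Qed.

Lemma dense_mdist {X} {A : set X} :
  (forall x (e : R), 0 < e -> exists2 a, A a & mdist x a < e) -> dense A.
Proof.
move=> denA O [x Ox] openO.
have /nbhs_ballP[e /= e0 xeO] : nbhs x O by exact: open_nbhs_nbhs.
have [a Aa xa] := denA x e e0.
by exists a; split=> //; apply: xeO; rewrite ballEmdist.
Qed.

Lemma mdist_eq0 X (x y : X) : (mdist x y == 0) = (x == y).
Proof. by apply/eqP/eqP => [/mdist_positivity//|->]; exact: mdistxx. Qed.

(** Every map is a set-theoretic quotient onto its range, by the relation of
    having the same image. *)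
Lemma dense_inclusion_quotient {X Y} (j : X -> Y) :
  dense (range j) -> inclusion_quotient j.
Proof.
move=> denj; split=> //; exists [rel x y | j x == j y].
  by move=> x y z; split=> //= /eqP ->.
by move=> x y; split=> /eqP.
Qed.

Lemma lipschitz_bound_comp {X Y Z} (a b : R) (j : X -> Y) (g : Y -> Z) :
  0 <= b -> lipschitz_bound a j -> lipschitz_bound b g ->
  lipschitz_bound (b * a) (g \o j).
Proof.
move=> b0 ja gb x y; rewrite (le_trans (gb _ _))// -mulrA ler_wpM2l//.
Qed.

(** When bounds of the factors multiply to the optimal constant of a composite,
    each of them is optimal: lowering one, with the other positive, would lower
    the product. *)
Lemma is_lipschitz_compW {X Y Z} (a b : R) (j : X -> Y) (g : Y -> Z) :
  0 < a -> 0 < b -> lipschitz_bound a j -> lipschitz_bound b g ->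
  is_lipschitz (b * a) (g \o j) -> is_lipschitz a j /\ is_lipschitz b g.
Proof.
move=> a0 b0 ja gb [_ _ opt]; split; split=> //; try exact: ltW.
- move=> a' a'0 ja'; rewrite -(ler_pM2l b0); apply: opt.
    by rewrite mulr_ge0 // ltW.
  by apply: lipschitz_bound_comp => //; exact: ltW.
- move=> b' b'0 gb'; rewrite -(ler_pM2r a0); apply: opt.
    by rewrite mulr_ge0 // ltW.
  exact: lipschitz_bound_comp.
Qed.

(** A Cauchy filter is pushed forward to a Cauchy filter, whose limit stays in
    the closed range; the scaling then pulls the convergence back. *)
Lemma similitude_complete {X Y} {K : R} (f : X -> Y) :
  0 < K -> (forall x y, mdist (f x) (f y) = K * mdist x y) ->
  closed (range f) -> complete_metric Y -> complete_metric X.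
Proof.
move=> K0 fK clf complY F PF /cauchyP cauF.
have cauf : cauchy (f @ F).
  apply/cauchy_exP => e e0; have [x Fx] := cauF _ (divr_gt0 e0 K0).
  exists (f x); apply: (@filterS _ F _ (ball x (e / K))) Fx => y /=.
  rewrite !ballEmdist /= fK.
  by rewrite ltr_pdivlMr// mulrC.
have [l Fl] := complY (f @ F) _ cauf.
have [x _ fxl] : range f l.
  apply: (@closed_cvg _ _ F _ f (range f) clf _ l Fl).
  by near=> y; exists y.
exists x; apply/fcvg_ballP => e e0.
have Fle : F (f @^-1` ball l (K * e)) by exact: (cvg_ball Fl (mulr_gt0 K0 e0)).
apply: filterS Fle => y /=.
by rewrite !ballEmdist /= -fxl fK ltr_pM2l.
Unshelve. all: by end_near. Qed.

End MetricFacts.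

Section ScaledSubspace.
Context {R : realType} {E : metricType R} (A : set E) {K : R}.

(** The proof of [0 < K] is an argument of the type so that the instance of
    metric space below, which depends on it, can be inferred from the type. *)
Definition scaled_subspace of 0 < K : Type := set_type A.

Context (K0 : 0 < K).
Local Notation S := (scaled_subspace K0).

HB.instance Definition _ := Choice.copy S (set_type A).

Definition scaled_incl (x : S) : E := \val x.

Definition scaled_dist (x y : S) : R :=
  K^-1 * mdist (scaled_incl x) (scaled_incl y).

Lemma scaled_distxx x : scaled_dist x x = 0.
Proof. by rewrite /scaled_dist mdistxx mulr0. Qed.

Lemma scaled_dist_positivity x y : scaled_dist x y = 0 -> x = y.
Proof.
move=> /eqP; rewrite mulf_eq0 invr_eq0 gt_eqF//= mdist_eq0 => /eqP xy.
exact: val_inj.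
Qed.

Lemma scaled_dist_sym x y : scaled_dist x y = scaled_dist y x.
Proof. by rewrite /scaled_dist metric_sym. Qed.

Lemma scaled_dist_triangle y x z :
  scaled_dist x z <= scaled_dist x y + scaled_dist y z.
Proof.
by rewrite -mulrDr ler_wpM2l ?invr_ge0 ?(ltW K0)// metric_triangle.
Qed.

HB.instance Definition _ := @isMetric.Build R S scaled_dist
  scaled_distxx scaled_dist_positivity scaled_dist_sym scaled_dist_triangle.

Lemma mdist_scaled_incl (x y : S) :
  mdist (scaled_incl x) (scaled_incl y) = K * mdist x y.
Proof. by rewrite [mdist x y]/(scaled_dist x y) mulVKf ?gt_eqF. Qed.

Lemma range_scaled_incl : range scaled_incl = A.
Proof.
apply/seteqP; split=> [_ [x _ <-]|y Ay]; first exact: set_valP.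
by exists (SigSub (mem_set Ay)).
Qed.

Lemma scaled_subspace_complete :
  closed A -> complete_metric E -> complete_metric S.
Proof.
move=> clA; apply: (similitude_complete scaled_incl K0 mdist_scaled_incl).
by rewrite range_scaled_incl.
Qed.

End ScaledSubspace.

(** Points at pseudodistance zero have the same image, so [T] can be evaluated
    on a class at any representative. *)
Lemma repr_quotient_proj (R : realType) (M E : metricType R) (K : R)
    (K0 : 0 < K) (T : M -> E) (x : M) :
  T (repr (quotient_proj (pullback_pseudometric K0 T) x)) = T x.
Proof.
set dT := pullback_pseudometric K0 T.
apply/eqP; rewrite -mdist_eq0; apply/eqP/(mulfI (lt0r_neq0 (_ : 0 < K^-1))).
  by rewrite invr_gt0.
rewrite mulr0 -[LHS]/(dT _ x) -mdist_quotient_proj /quotient_proj.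
by rewrite reprK mdistxx.
Qed.

Theorem lemma2p1 (R : realType) (M E : metricType R) (K : R) (T : M -> E)
    (complE : complete_metric E) (K0 : 0 < K) (lipT : is_lipschitz K T) :
  let dT := pullback_pseudometric K0 T in
  exists (MT : metricType R) (i : metric_quotient dT -> MT)
         (j : M -> MT) (Tbar : MT -> E),
    [/\ is_completion i /\ j = i \o quotient_proj dT,
        inclusion_quotient j,
        is_lipschitz 1 j,
        is_lipschitz K Tbar &
        T = Tbar \o j].
Proof.
move=> dT; set A := closure (range T).
have AT x : A (T x) by apply: subset_closure; exists x.
pose i (q : metric_quotient dT) : scaled_subspace A K0 :=
  SigSub (mem_set (AT (repr q))).
pose j := i \o quotient_proj dT.
pose Tbar := @scaled_incl R E A K K0.
have TbarK x y : mdist (Tbar x) (Tbar y) = K * mdist x y.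
  exact: mdist_scaled_incl.
have TbarjE x : Tbar (j x) = T x by exact: repr_quotient_proj.
have TE : T = Tbar \o j by apply/funext => x; rewrite /= TbarjE.
have denj : dense (range j).
  apply: dense_mdist => x e e0.
  have clx : closure (range T) (Tbar x) by exact: set_valP.
  have [_ [m _ <-]] := closure_mdist clx (mulr_gt0 K0 e0).
  rewrite -TbarjE TbarK ltr_pM2l// => xm.
  by exists (j m) => //; exists m.
have [jL TbarL] : is_lipschitz 1 j /\ is_lipschitz K Tbar.
  apply: is_lipschitz_compW => //; last by rewrite mulr1 -TE.
  - move=> x y; rewrite mul1r -(ler_pM2l K0) -TbarK !TbarjE.
    by case: lipT.
  - by move=> x y; rewrite TbarK.
exists (scaled_subspace A K0), i, j, Tbar; split=> //.
  split=> //; split.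
  - by apply: scaled_subspace_complete => //; exact: closed_closure.
  - (* Both distances unfold to the same expression in the values of [T] at
       the chosen representatives. *)
    by [].
  - move=> O O0 /(denj O O0)[y [Oy [m _ jmy]]].
    by exists y; split=> //; exists (quotient_proj dT m).
exact: dense_inclusion_quotient.
Qed.
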